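(* Let $G$ be a connected graph with $n\geq 5$ vertices. Then $$\max\{\chi(G)-1,\gamma(G)\}\leq\Omega_{uc}(G)\leq\min\left\{\tfrac{3}{2}(\chi(G)-1)\gamma(G),\ i(G)\chi(G)\right\}\leq\tfrac14 n^2.$$ Moreover, $\chi(G)-1=\Omega_{uc}(G)$ if and only if $G$ is a cone graph, i.e. there is a vertex whose closed neighborhood is the whole vertex set.
   Context: Graphs are finite, simple and undirected. A coloring of $G=(V,E)$ is a map $c:V\to\{0,1,2,\dots\}$ with $c(u)\neq c(v)$ whenever $u,v$ are adjacent. Given $(G,c)$, a set $D\subseteq V$ is an up--color dominating $c$--set if (1) every vertex $v\notin D$ has a neighbor $d\in D$ with $c(v)<c(d)$, and (2) $D$ contains no vertex of color $0$. The weight of $D$ is $\sum_{v\in D}c(v)$, and $\omega_{uc}(G,c)$ is the minimum weight of an up--color dominating $c$--set. $\Omega_{uc}(G)$ is the minimum of $\omega_{uc}(G,c)$ over all colorings $c$ of $G$. $\chi(G)$ is the chromatic number, $\gamma(G)$ the domination number, and $i(G)$ the independent domination number (minimum size of an independent dominating set). *)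

(* Defs.v *)
From mathcomp Require Import all_boot.
From mathcomp Require Import boolp.

Set Implicit Arguments.
Unset Strict Implicit.
Unset Printing Implicit Defensive.

Record sgraph := SGraph {
  vertex :> finType;
  adj : rel vertex;
  adj_sym : symmetric adj;
  adj_irrefl : irreflexive adj }.

(* [0] is a junk value, returned only when [P] holds of no natural number. *)
Definition nat_min (P : nat -> Prop) : nat :=
  match pselect (exists n, `[< P n >]) with
  | left exP => ex_minn exP
  | right _ => 0
  end.

Lemma nat_minP (P : nat -> Prop) : (exists n, P n) ->
  P (nat_min P) /\ forall m, P m -> nat_min P <= m.
Proof.
case=> n Pn; rewrite /nat_min; case: pselect => [exP | []]; last first.
  by exists n; apply/asboolP.
case: ex_minnP => m /asboolP Pm min_m; split=> // k Pk.
by apply: min_m; apply/asboolP.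
Qed.

Section DominationInvariants.
Variable G : sgraph.
Implicit Types (c : G -> nat) (D : {set G}) (u v : G).

Definition connected_graph := forall u v, connect (@adj G) u v.

Definition closed_nbhd v : {set G} := [set u | (u == v) || adj v u].

Definition cone_graph := exists v, closed_nbhd v = [set: G].

Definition coloring c := forall u v, adj u v -> c u != c v.

Definition chromatic_number : nat :=
  nat_min (fun k => exists2 c, coloring c & forall v, c v < k).

Definition dominating D :=
  forall v, v \notin D -> exists2 d, d \in D & adj v d.

Definition independent D :=
  forall u v, u \in D -> v \in D -> ~~ adj u v.

Definition domination_number : nat :=
  nat_min (fun k => exists2 D, dominating D & #|D| = k).

Definition independent_domination_number : nat :=
  nat_min (fun k => exists2 D, independent D /\ dominating D & #|D| = k).

Definition up_color_dominating c D :=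
  (forall v, v \notin D -> exists d, [/\ d \in D, adj v d & c v < c d]) /\
  (forall v, v \in D -> c v <> 0).

Definition weight c D : nat := \sum_(v in D) c v.

Definition omega_uc c : nat :=
  nat_min (fun k => exists2 D, up_color_dominating c D & weight c D = k).

(* If a vertex of color 0 is isolated, then [c] admits no up-color dominating
   set and [omega_uc c] is junk; such colorings are left out of the minimum.
   In a connected graph with at least two vertices there are none, see
   [up_color_dominating_exists]. *)
Definition Omega_uc : nat :=
  nat_min (fun k => exists c,
    [/\ coloring c, exists D, up_color_dominating c D & omega_uc c = k]).

Lemma up_color_dominating_exists c :
  connected_graph -> 1 < #|G| -> coloring c ->
  exists D, up_color_dominating c D.
Proof.
move=> conG cardG colc; exists [set v | 0 < c v]; split; last first.
  by move=> v; rewrite inE => + cv0; rewrite cv0.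
move=> v; rewrite inE -eqn0Ngt => /eqP cv0.
have [u uv]: exists u, u != v.
  have /card_gt0P[u] : 0 < #|[set~ v]| by rewrite cardsC1; case: #|G| cardG => [|[]].
  by rewrite !inE; exists u.
have /connectP[[|d p] /=] := conG v u; first by move=> _ uE; rewrite uE eqxx in uv.
case/andP=> vd _ _; exists d.
have cd : 0 < c d by rewrite lt0n -cv0 eq_sym; apply: colc.
by rewrite inE cv0 cd vd.
Qed.

End DominationInvariants.

(* Main.v *)
(** For the bound [3/2 * (chi - 1) * gamma], let [c] be an optimal coloring and
    [D] a minimum dominating set. Put [k = chi - 1] and recolor [D] by the
    colors [k..2k], either by [k + c] or by [k + (k - c)]; the better of the two
    has weight at most [3/2 * k * #|D|]. Outside [D] use the colors [0..k] in
    such a way that the only color that occurs on both sides, namely [k], comes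
    from the same class of [c]; then no edge is spoiled and every vertex outside
    [D] has a larger color in [D].

    For the bound [n ^ 2 / 4], it suffices that [i = 1] or [i + chi <= n]. Let [I]
    be a minimum independent dominating set and suppose [chi > n - i]. Then the
    complement of [I] is a clique, and some [v] in [I] is adjacent to all of it,
    since otherwise [n - i] colors suffice. If [I] contains some [u <> v], then a
    maximal independent set through a neighbor of [u] misses [u], [v] and the
    rest of the clique, so it has fewer than [i] vertices. *)
Require Import Defs.
From mathcomp Require Import all_boot all_order all_algebra.
From mathcomp Require Import boolp zify lra.
Import Order.TTheory GRing.Theory Num.Theory.

Set Implicit Arguments.
Unset Strict Implicit.
Unset Printing Implicit Defensive.

(** * Optimal witnesses for the invariants *)

Lemma nat_min_le (P : nat -> Prop) m : P m -> nat_min P <= m.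
Proof. by move=> Pm; have [|_ ->] := @nat_minP P; [exists m| |]. Qed.

(** Numbering the values of [f] turns them into natural colors. Below, vertices themselves serve as
    colors, and colors are counted by the size of an image. *)
Lemma coloring_bounded_card_image (G : sgraph) (T : finType) (f : G -> T) :
  (forall x y, adj x y -> f x != f y) ->
  exists2 c, coloring c & forall v : G, c v < #|f @: [set: G]|.
Proof.
move=> fP; exists (fun v => index (f v) (enum (f @: [set: G]))) => [x y xy|v].
  apply: contra (fP x y xy) => /eqP fxy; apply/eqP.
  by apply: (index_inj (f x) _ _ fxy); rewrite mem_enum imset_f.
by rewrite cardE index_mem mem_enum imset_f.
Qed.

Lemma chromatic_number_coloring (G : sgraph) :
  exists2 c, coloring c & forall v : G, c v < chromatic_number G.
Proof.
suff ex : exists k, exists2 c, coloring c & forall v : G, c v < k.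
  exact: (nat_minP ex).1.
exists #|id @: [set: G]|; apply: coloring_bounded_card_image => x y.
by apply: contraTneq => ->; rewrite adj_irrefl.
Qed.

Lemma chromatic_number_le (G : sgraph) (c : G -> nat) k :
  coloring c -> (forall v, c v < k) -> chromatic_number G <= k.
Proof. by move=> cc ck; apply: nat_min_le; exists c. Qed.

Lemma chromatic_number_le_image (G : sgraph) (T : finType) (f : G -> T) :
  (forall x y, adj x y -> f x != f y) ->
  chromatic_number G <= #|f @: [set: G]|.
Proof.
by move=> /coloring_bounded_card_image[c]; apply: chromatic_number_le.
Qed.

Lemma chromatic_number_le_card (G : sgraph) : chromatic_number G <= #|G|.
Proof.
rewrite -cardsT; apply: leq_trans (leq_imset_card id _).
apply: chromatic_number_le_image => x y.
by apply: contraTneq => ->; rewrite adj_irrefl.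
Qed.

Lemma domination_number_attained (G : sgraph) :
  exists2 D : {set G}, dominating D & #|D| = domination_number G.
Proof.
suff ex : exists k, exists2 D : {set G}, dominating D & #|D| = k.
  exact: (nat_minP ex).1.
by exists #|[set: G]|, setT => // v; rewrite inE.
Qed.

Lemma domination_number_le (G : sgraph) (D : {set G}) :
  dominating D -> domination_number G <= #|D|.
Proof. by move=> dD; apply: nat_min_le; exists D. Qed.

(** A maximal independent set containing [D] dominates: a vertex outside it without neighbors in it
    could be added. *)
Lemma independent_extend (G : sgraph) (D : {set G}) : independent D ->
  exists E : {set G}, [/\ D \subset E, independent E & dominating E].
Proof.
move=> iD; pose P (E : {set G}) := `[< independent E >].
have PD : P D by apply/asboolP.
have [E /maxsetP[/asboolP iE maxE] DE] := maxset_exists PD.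
exists E; split=> // v vE.
have [/existsP[d /andP[dE vd]]|/existsPn noE] :=
  boolP [exists d, (d \in E) && adj v d]; first by exists d.
suff vE' : v |: E = E by rewrite -vE' setU11 in vE.
apply: maxE (subsetUr _ _); apply/asboolP => x y.
have noEv z : z \in E -> ~~ adj v z.
  by move=> zE; have := noE z; rewrite zE.
rewrite !in_setU1 => /predU1P[->|xE] /predU1P[->|yE].
- by rewrite adj_irrefl.
- exact: noEv.
- by rewrite adj_sym noEv.
- exact: iE.
Qed.

Lemma independent_domination_number_attained (G : sgraph) :
  exists2 D : {set G}, independent D /\ dominating D
    & #|D| = independent_domination_number G.
Proof.
suff ex : exists k, exists2 D : {set G}, independent D /\ dominating D & #|D| = k.
  exact: (nat_minP ex).1.
have [|D [_ iD dD]] := @independent_extend G set0; last by exists #|D|, D.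
by move=> x y; rewrite inE.
Qed.

Lemma independent_domination_number_le (G : sgraph) (D : {set G}) :
  independent D -> dominating D -> independent_domination_number G <= #|D|.
Proof. by move=> iD dD; apply: nat_min_le; exists D. Qed.

(** * Up-color dominating sets and their weight *)

Lemma omega_uc_attained (G : sgraph) (c : G -> nat) :
  (exists D, up_color_dominating c D) ->
  exists2 D, up_color_dominating c D & weight c D = omega_uc c.
Proof.
case=> D0 cD0.
suff ex : exists k, exists2 D, up_color_dominating c D & weight c D = k.
  exact: (nat_minP ex).1.
by exists (weight c D0), D0.
Qed.

Lemma Omega_uc_le (G : sgraph) (c : G -> nat) D :
  coloring c -> up_color_dominating c D -> Omega_uc G <= weight c D.
Proof.
move=> cc cD; apply: (@leq_trans (omega_uc c)); last first.
  by apply: nat_min_le; exists D.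
by apply: nat_min_le; exists c; split=> //; exists D.
Qed.

Lemma up_color_dominating_color_le (G : sgraph) (c : G -> nat) D :
  up_color_dominating c D -> forall v, exists2 d, d \in D & c v <= c d.
Proof.
case=> cD _ v; have [vD|/cD[d [dD _ /ltnW]]] := boolP (v \in D); first by exists v.
by exists d.
Qed.

Lemma up_color_dominating_dominating (G : sgraph) (c : G -> nat) D :
  up_color_dominating c D -> dominating D.
Proof. by case=> cD _ v /cD[d [dD vd _]]; exists d. Qed.

Lemma color_le_weight (G : sgraph) (c : G -> nat) (D : {set G}) d : d \in D -> c d <= weight c D.
Proof. by move=> dD; rewrite /weight (bigD1 d) //= leq_addr. Qed.

Lemma card_le_weight (G : sgraph) (c : G -> nat) D :
  up_color_dominating c D -> #|D| <= weight c D.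
Proof.
case=> _ c0; rewrite -sum1_card; apply: leq_sum => v /c0.
by rewrite lt0n => /eqP.
Qed.

(** * Connected graphs: lower bounds *)

Section Connected.

Context {G : sgraph} (conG : connected_graph G) (cardG : 1 < #|G|).

Lemma connected_neighbor (v : G) : exists d, adj v d.
Proof.
have [u uv]: exists u, u != v.
  have /card_gt0P[u] : 0 < #|[set~ v]| by rewrite cardsC1 -subn1 subn_gt0.
  by rewrite !inE; exists u.
have /connectP[[|d p] /=] := conG v u; first by move=> _ uE; rewrite uE eqxx in uv.
by case/andP=> vd _ _; exists d.
Qed.

Lemma chromatic_number_gt1 : 1 < chromatic_number G.
Proof.
have [c cc ck] := chromatic_number_coloring G.
have /card_gt0P[v _] : 0 < #|G| by exact: ltnW.
have [d /cc cvd] := connected_neighbor v.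
by have := ck v; have := ck d; move: cvd; lia.
Qed.

Lemma Omega_uc_attained : exists c D,
  [/\ coloring c, up_color_dominating c D & @weight G c D = Omega_uc G].
Proof.
have [] := @nat_minP (fun k => exists c : G -> nat,
  [/\ coloring c, exists D, up_color_dominating c D & omega_uc c = k]).
  have [c cc _] := chromatic_number_coloring G.
  exists (omega_uc c), c; split=> //.
  exact: up_color_dominating_exists.
rewrite -/(Omega_uc G) => -[c [cc /omega_uc_attained[D cD wD] cO]] _.
by exists c, D; rewrite wD.
Qed.

(** Every color is at most the color of some vertex of [D], hence at most the weight of [D]. *)
Lemma chromatic_number_le_Omega_uc : chromatic_number G <= (Omega_uc G).+1.
Proof.
have [c [D [cc cD <-]]] := Omega_uc_attained.
apply: chromatic_number_le cc _ => v.
have [d dD cvd] := up_color_dominating_color_le cD v.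
exact: leq_trans cvd (color_le_weight _ dD).
Qed.

Lemma domination_number_le_Omega_uc : domination_number G <= Omega_uc G.
Proof.
have [c [D [cc cD <-]]] := Omega_uc_attained.
apply: leq_trans (card_le_weight cD).
exact/domination_number_le/up_color_dominating_dominating/cD.
Qed.

(** * Upper bounds by recoloring a dominating set *)

Lemma Omega_uc_le_independent :
  Omega_uc G <= independent_domination_number G * chromatic_number G.
Proof.
have [D [iD dD] <-] := independent_domination_number_attained G.
have [c cc ck] := chromatic_number_coloring G.
(* The values of [c] stay below the chromatic number, so that number is a fresh color above all
   others; independence of [D] allows it on all of [D]. *)
pose c' v := if v \in D then chromatic_number G else c v.
have -> : #|D| * chromatic_number G = weight c' D.
  by rewrite -sum_nat_const; apply: eq_bigr => v vD; rewrite /c' vD.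
apply: Omega_uc_le; last split.
- move=> u v uv; rewrite /c'; case: ifP => uD; case: ifP => vD.
  + by have := iD u v uD vD; rewrite uv.
  + by rewrite gtn_eqF.
  + by rewrite ltn_eqF.
  + exact: cc.
- move=> v vD; have [d dD' vd] := dD v vD.
  by exists d; rewrite /c' dD' (negPf vD).
- by move=> v vD; rewrite /c' vD; have := chromatic_number_gt1; lia.
Qed.

(* [tau] recolors the vertices outside [D], and [rho] is the excess over [k] of
   the new colors of [D]; the hypothesis on [tau] and [rho] says that the color
   [k] is only shared within one class of [c]. *)
Lemma Omega_uc_le_shift (c : G -> nat) (D : {set G}) k (tau rho : nat -> nat) :
    0 < k -> coloring c -> (forall v, c v <= k) -> dominating D ->
    {in [pred a | a <= k] &, injective tau} ->
    {in [pred a | a <= k] &, injective rho} ->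
    (forall a, a <= k -> tau a <= k) ->
    (forall a b, a <= k -> b <= k -> tau a = k -> rho b = 0 -> a = b) ->
  Omega_uc G <= \sum_(v in D) (k + rho (c v)).
Proof.
move=> k_gt0 cc ck dD tauI rhoI tauk share.
pose c' v := if v \in D then k + rho (c v) else tau (c v).
(* The left side is at most [k] and the right side at least [k]. If both equal [k], then [share]
   gives [c u = c d], impossible for an edge. *)
have lt_c' u d : adj u d -> tau (c u) < k + rho (c d).
  move=> /cc/eqP cud; have := tauk _ (ck u); have := share _ _ (ck u) (ck d).
  have [tk|] := eqVneq (tau (c u)) k; last lia.
  by have [r0 /(_ tk r0)//|] := eqVneq (rho (c d)) 0; last lia.
have -> : \sum_(v in D) (k + rho (c v)) = weight c' D.
  by apply: eq_bigr => v vD; rewrite /c' vD.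
apply: Omega_uc_le; last split.
- move=> u v uv; have cuv := cc _ _ uv; rewrite /c'.
  case: ifP => uD; case: ifP => vD.
  + by rewrite eqn_add2l (inj_in_eq rhoI) ?inE ?ck.
  + by rewrite gtn_eqF // lt_c' // adj_sym.
  + by rewrite ltn_eqF // lt_c'.
  + by rewrite (inj_in_eq tauI) ?inE ?ck.
- move=> v vD; have [d dD' vd] := dD v vD.
  by exists d; rewrite /c' dD' (negPf vD) lt_c'.
- by move=> v vD; rewrite /c' vD; lia.
Qed.

Lemma Omega_uc_le_domination :
  2 * Omega_uc G <= 3 * (chromatic_number G).-1 * domination_number G.
Proof.
have [D dD <-] := domination_number_attained G.
have [c cc ck'] := chromatic_number_coloring G.
have := chromatic_number_gt1; set k := (chromatic_number G).-1 => chi_gt1.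
have k_gt0 : 0 < k by rewrite /k; lia.
have ck v : c v <= k by have := ck' v; rewrite /k; lia.
(* Here the shared color [k] comes from class 0 of [c] on both sides; in [Omega2] it comes from
   class [k]. *)
have Omega1 : Omega_uc G <= \sum_(v in D) (k + c v).
  apply: (@Omega_uc_le_shift c D k (fun a => k - a) id) => //.
  - by move=> a b; rewrite !inE; lia.
  - by move=> a _; exact: leq_subr.
  - by lia.
have Omega2 : Omega_uc G <= \sum_(v in D) (k + (k - c v)).
  apply: (@Omega_uc_le_shift c D k id (fun a => k - a)) => //.
  - by move=> a b; rewrite !inE; lia.
  - by lia.
(* Each vertex of [D] contributes [(k + c v) + (k + (k - c v)) = 3 * k] to the sum of the two
   bounds. *)
rewrite mul2n -addnn; apply: leq_trans (leq_add Omega1 Omega2) _.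
rewrite -big_split /= mulnC -sum_nat_const; apply: leq_sum => v _.
by have := ck v; lia.
Qed.

(** * The bound by a quarter of the squared order *)

Lemma independent_domination_number1_or :
  independent_domination_number G = 1 \/
  independent_domination_number G + chromatic_number G <= #|G|.
Proof.
have [I [iI dI] cardI] := independent_domination_number_attained G.
set i := independent_domination_number G in cardI *.
have [|chiG] := leqP (i + chromatic_number G) #|G|; [by right|left].
have cardIC : #|~: I| = #|G| - i by rewrite cardsCs setCK cardI.
have le_iG : i <= #|G| by rewrite -cardI max_card.
have [v0 v0I] : exists v, v \in I.
  have /card_gt0P[v _] : 0 < #|G| by exact: ltnW.
  by have [vI|/dI[d dI' _]] := boolP (v \in I); [exists v|exists d].
have no_coloring (f : G -> G) : #|f @: [set: G]| <= #|G| - i ->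
    ~ forall x y, adj x y -> f x != f y.
  by move=> card_f /chromatic_number_le_image; lia.
have clique a b : a \notin I -> b \notin I -> a != b -> adj a b.
  move=> aI bI ab; apply/negPn/negP => nab.
  (* Nonadjacent [a] and [b] could share a color, and [I] takes the single color [v0]: in all 1 + (n
     - i - 1) colors. *)
  pose f x := if x \in I then v0 else if x == a then b else x.
  have fI x : x \in I -> f x = v0 by rewrite /f => ->.
  have fNI x : x \notin I -> f x \notin I.
    by rewrite /f => xI; rewrite (negPf xI); case: ifP.
  apply: (no_coloring f) => [|x y xy].
    have sub : f @: [set: G] \subset v0 |: (~: I :\ a).
      apply/subsetP => _ /imsetP[x _ ->]; rewrite !inE.
      have [/fI ->|xI] := boolP (x \in I); first by rewrite eqxx.
      rewrite (fNI _ xI) /f (negPf xI) andbT.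
      by have [_|->] := eqVneq x a; rewrite ?orbT // [b == a]eq_sym ab orbT.
    apply: leq_trans (subset_leq_card sub) _; apply: leq_trans (leq_card_setU _ _) _.
    by rewrite cards1 -cardIC [#|~: I|](cardsD1 a) inE aI.
  have nxy : x != y by apply: contraTneq xy => ->; rewrite adj_irrefl.
  have [xI|xI] := boolP (x \in I); have [yI|yI] := boolP (y \in I).
  - by have := iI x y xI yI; rewrite xy.
  - by rewrite fI //; apply: contraNneq (fNI y yI) => <-.
  - by rewrite [f y]fI //; apply: contraNneq (fNI x xI) => ->.
  - rewrite /f (negPf xI) (negPf yI).
    have [xa|_] := eqVneq x a; have [ya|_] := eqVneq y a => //.
    + by rewrite xa ya eqxx in nxy.
    + by apply: contraNneq nab => ->; rewrite -xa.
    + by apply: contraNneq nab => <-; rewrite -ya adj_sym.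
have [v vI vadj] : exists2 v, v \in I & forall x, x \notin I -> adj v x.
  have [/existsP[v /andP[vI /forallP vadj]]|/existsPn nov] :=
    boolP [exists v, (v \in I) && [forall x, (x \notin I) ==> adj v x]].
    by exists v => // x xI; have := vadj x; rewrite xI.
  have nonadj x : x \in I -> exists z, (z \notin I) && ~~ adj x z.
    move=> xI; have := nov x; rewrite xI /= => /forallPn[z].
    by rewrite negb_imply; exists z.
  (* Each vertex of [I] takes the color of a non-neighbor outside [I], so the n - i vertices outside
     [I] suffice as colors. The default [x] never occurs on [I], by [nonadj]. *)
  pose f x := if x \in I then odflt x [pick z | (z \notin I) && ~~ adj x z] else x.
  have fI x : x \in I -> (f x \notin I) && ~~ adj x (f x).
    move=> xI; rewrite /f xI; case: pickP => [z //|no].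
    by have [z] := nonadj x xI; rewrite no.
  have fNI x : x \notin I -> f x = x by rewrite /f => /negPf ->.
  case: (no_coloring f) => [|x y xy].
    rewrite -cardIC; apply: subset_leq_card.
    apply/subsetP => _ /imsetP[x _ ->]; rewrite inE.
    have [/fI/andP[] //|xI] := boolP (x \in I).
    by rewrite fNI.
  have [xI|xI] := boolP (x \in I); have [yI|yI] := boolP (y \in I).
  - by have := iI x y xI yI; rewrite xy.
  - by rewrite [f y]fNI //; apply: contraTneq xy => <-; case/andP: (fI x xI).
  - rewrite [f x]fNI // adj_sym in xy *.
    by apply: contraTneq xy => ->; case/andP: (fI y yI).
  - by rewrite !fNI //; apply: contraTneq xy => ->; rewrite adj_irrefl.
have [/existsP[u /andP[uI uv]]|/existsPn nou] :=
  boolP [exists u, (u \in I) && (u != v)]; last first.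
  rewrite -cardI; apply/eqP/cards1P; exists v; apply/setP => x; rewrite inE.
  have [->//|xv] := eqVneq x v.
  by have := nou x; rewrite xv andbT => /negPf.
have [w uw] := connected_neighbor u.
have wI : w \notin I by apply/negP => wI; have := iI u w uI wI; rewrite uw.
have [|E [wE iE dE]] := @independent_extend G [set w].
  by move=> x y /set1P-> /set1P->; rewrite adj_irrefl.
rewrite sub1set in wE.
(* [w] is adjacent to [u], to [v] and to the rest of the clique. Hence [E] has at most 1 + (i - 2)
   vertices, against the minimality of i. *)
have sub : E \subset w |: (I :\ u :\ v).
  apply/subsetP => x xE; rewrite !inE.
  have [//|xw /=] := eqVneq x w.
  have nwx : ~~ adj w x by exact: iE.
  have xI : x \in I.
    by apply: contraNT nwx => xI; rewrite clique // eq_sym.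
  rewrite xI andbT; apply/andP; split.
    by apply: contraNneq nwx => ->; rewrite adj_sym vadj.
  by apply: contraNneq nwx => ->; rewrite adj_sym.
have := independent_domination_number_le iE dE.
have := leq_trans (subset_leq_card sub) (leq_card_setU _ _).
have := cardsD1 v (I :\ u); have := cardsD1 u I.
by rewrite cards1 !inE uI vI eq_sym uv -/i cardI; lia.
Qed.

Lemma independent_mul_chromatic_number_le : 3 < #|G| ->
  4 * (independent_domination_number G * chromatic_number G) <= #|G| ^ 2.
Proof.
(* If i = 1, then chi <= n and n >= 4 suffice; otherwise 4 i chi <= (i + chi)^2 <= n^2. *)
have [-> n4|le_n _] := independent_domination_number1_or.
  by have := chromatic_number_le_card G; nia.
apply: leq_trans (nat_AGM2 _ _) _; by rewrite leq_exp2r.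
Qed.

(** * The equality case: cone graphs *)

Lemma chromatic_number_eq_Omega_uc :
  chromatic_number G = (Omega_uc G).+1 <-> cone_graph G.
Proof.
split=> [chiO|[h hG]].
  have [c [D [cc cD wD]]] := Omega_uc_attained.
  have /card_gt0P[v0 _] : 0 < #|G| by exact: ltnW.
  have [d0 d0D _] := up_color_dominating_color_le cD v0.
  (* If every color in [D] were below the weight, so would be all colors of [c], and one color could
     be saved. So [d] carries the whole weight, and as colors in [D] are positive, [D] is just
     [d]. *)
  have [d dD cd] : exists2 d, d \in D & weight c D <= c d.
    have [/exists_inP[d dD cd]|/exists_inPn noD] :=
      boolP [exists d in D, weight c D <= c d]; first by exists d.
    suff : chromatic_number G <= weight c D by rewrite chiO wD ltnn.
    apply: chromatic_number_le cc _ => v.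
    have [d dD cvd] := up_color_dominating_color_le cD v.
    by apply: leq_ltn_trans cvd _; rewrite ltnNge noD.
  exists d; apply/setP => u; rewrite !inE.
  have D1 x : x \in D -> x = d.
    move=> xD; apply/eqP; apply: contraLR cd => xd.
    rewrite -ltnNge /weight (bigD1 d) //= (bigD1 x) ?xD //=.
    by have := cD.2 x xD; lia.
  have [->//|ud /=] := eqVneq u d.
  have uD : u \notin D by apply: contra ud => /D1 ->.
  by have [e /D1 ->] := up_color_dominating_dominating cD uD; rewrite adj_sym.
apply/eqP; rewrite eqn_leq chromatic_number_le_Omega_uc /=.
have hadj u : u != h -> adj h u.
  by move=> uh; have := in_setT u; rewrite -hG inE (negPf uh).
have [c cc ck] := chromatic_number_coloring G.
have chi_gt1 := chromatic_number_gt1.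
set k := (chromatic_number G).-1.
(* Swapping colors [c h] and [k] gives the apex [h] the top color; its neighbors, all other
   vertices, then lie strictly below. *)
pose t a := if a == c h then k else if a == k then c h else a.
have t_inj : injective t by rewrite /t => a b; do ?case: eqP; lia.
have th : t (c h) = k by rewrite /t eqxx.
have tk v : t (c v) <= k.
  by have := ck v; have := ck h; rewrite /t /k; do ?case: eqP; lia.
have -> : chromatic_number G = k.+1 by rewrite /k; lia.
rewrite ltnS.
have -> : k = weight (t \o c) [set h] by rewrite /weight big_set1 /= th.
apply: Omega_uc_le; last split.
- by move=> u v /cc cuv /=; rewrite (inj_eq t_inj).
- move=> v /[1!inE] vh; exists h; rewrite inE eqxx adj_sym hadj //=.
  split=> //; rewrite th ltn_neqAle tk andbT -th (inj_eq t_inj) eq_sym.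
  exact/cc/hadj.
- by move=> v /set1P-> /=; rewrite th /k; lia.
Qed.

End Connected.

(** * The inequalities over the rationals *)

Local Open Scope ring_scope.

Theorem theorem4 (G : sgraph) (conG : connected_graph G) (n5 : (5 <= #|G|)%N) :
  let chi : rat := (chromatic_number G)%:R in
  let gamma : rat := (domination_number G)%:R in
  let i : rat := (independent_domination_number G)%:R in
  let Omega : rat := (Omega_uc G)%:R in
  let n : rat := #|G|%:R in
  [/\ Num.max (chi - 1) gamma <= Omega,
      Omega <= Num.min (3 / 2 * (chi - 1) * gamma) (i * chi),
      Num.min (3 / 2 * (chi - 1) * gamma) (i * chi) <= 1 / 4 * n ^+ 2
    & chi - 1 = Omega <-> cone_graph G].
Proof.
have cardG : (1 < #|G|)%N by apply: leq_trans n5.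
move=> chi gamma i Omega n.
have chi1 : chi - 1 = (chromatic_number G).-1%:R.
  by rewrite -subn1 natrB // ltnW // chromatic_number_gt1.
split.
- rewrite ge_max ler_nat domination_number_le_Omega_uc // andbT.
  by rewrite lerBlDr natr1 ler_nat chromatic_number_le_Omega_uc.
- rewrite le_min -natrM ler_nat Omega_uc_le_independent // andbT chi1.
  have := Omega_uc_le_domination conG cardG.
  by rewrite -(ler_nat rat) !natrM -/gamma -/Omega; lra.
- rewrite ge_min; apply/orP; right.
  have := independent_mul_chromatic_number_le conG cardG (ltnW n5).
  by rewrite -(ler_nat rat) natrX !natrM -/i -/chi -/n; lra.
- rewrite -chromatic_number_eq_Omega_uc //.
  by split=> [/eqP|chiO]; [rewrite subr_eq natr1 eqr_nat => /eqP|
    rewrite /chi chiO -natr1 addrK].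
Qed.
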